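(* Let $\mathcal K$ be a complete idempotent semiring, let $X$ be a complete right $\mathcal K$-semimodule, let $V\subset X$ be a complete subsemimodule, and let $x\in X$. Then $$\forall v\in V,\quad v\backslash P_V(x)=v\backslash x,$$ and $$x\in V\iff x\backslash P_V(x)=x\backslash x .$$
   Context: A semiring $(\mathcal K,\oplus,\otimes,\varepsilon,e)$ (neutral elements $\varepsilon$ for $\oplus$ and $e$ for $\otimes$, with $\varepsilon$ absorbing for $\otimes$) is idempotent if $a\oplus a=a$ for all $a$. An idempotent commutative monoid carries the natural order $a\le b\iff a\oplus b=b$. An ordered set is complete if every subset $U$ has a least upper bound $\bigvee U$ (it is then a complete lattice). A map $f$ between complete ordered sets is continuous if $f(\bigvee U)=\bigvee f(U)$ for every subset $U$ (including $U=\varnothing$). An idempotent semiring is complete if it is complete for its natural order and all its left and right multiplications $x\mapsto ax$, $x\mapsto xa$ are continuous. A right $\mathcal K$-semimodule is a commutative monoid $(X,\oplus,\varepsilon)$ with a right action $(x,\lambda)\mapsto x\lambda$ satisfying $x(\lambda\mu)=(x\lambda)\mu$, $(x\oplus y)\lambda=x\lambda\oplus y\lambda$, $x(\lambda\oplus\mu)=x\lambda\oplus x\mu$, $x\varepsilon=\varepsilon$, $xe=x$; its addition is then idempotent. It is complete if it is complete for its natural order and the maps $X\to X$, $x\mapsto x\lambda$ ($\lambda\in\mathcal K$) and $\mathcal K\to X$, $\mu\mapsto v\mu$ ($v\in X$) are all continuous. For $x,y\in X$: $x\backslash y=\max\{\lambda\in\mathcal K\mid x\lambda\le y\}$ (this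 maximum exists). A complete subsemimodule of $X$ is a subset stable under arbitrary suprema (of $X$) and under the action of scalars. For such $V$, $P_V:X\to X$ is $P_V(x)=\max\{v\in V\mid v\le x\}$. *)

(* Defs.v *)
From HB Require Import structures.
From mathcomp Require Import all_boot all_order all_algebra.
From mathcomp Require Import boolp classical_sets.

Set Implicit Arguments.
Unset Strict Implicit.
Unset Printing Implicit Defensive.

Import Order.TTheory GRing.Theory.

Local Open Scope classical_set_scope.
Local Open Scope ring_scope.

HB.mixin Record Nmodule_isIdempotent M of GRing.Nmodule M := {
  addxx : forall x : M, x + x = x
}.

#[short(type="idemNmodType")]
HB.structure Definition IdemNmodule :=
  {M of Nmodule_isIdempotent M & GRing.Nmodule M}.

(* [pzSemiRingType] allows the trivial semiring, in which 0 = 1. *)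
#[short(type="idemSemiRingType")]
HB.structure Definition IdemSemiRing :=
  {K of Nmodule_isIdempotent K & GRing.PzSemiRing K}.

#[short(type="idemLSemiModType")]
HB.structure Definition IdemLSemiModule (R : pzSemiRingType) :=
  {X of Nmodule_isIdempotent X & GRing.LSemiModule R X}.

(* Over idempotent scalars the addition of every semimodule is idempotent, so
   that [idemLSemiModType K^c] is no restriction of [lSemiModType K^c]. *)
Lemma lsemimod_addxx (K : idemSemiRingType) (X : lSemiModType K^c) (x : X) :
  x + x = x.
Proof. by rewrite -{1 2}[x]scale1r -scalerDl (addxx (1 : K)) scale1r. Qed.

(* An alias of [M] that carries the natural order. *)
Definition natural (M : idemNmodType) : Type := M.

Fact natural_display : Order.disp_t. Proof. exact. Qed.

Section NaturalOrder.
Variable M : idemNmodType.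

Let le (x y : M) := x + y == y.

Let le_refl : reflexive le.
Proof. by move=> x; apply/eqP; exact: addxx. Qed.

Let le_anti : antisymmetric le.
Proof. by move=> x y /andP[/eqP xy /eqP yx]; rewrite -yx addrC xy. Qed.

Let le_trans : transitive le.
Proof. by move=> y x z /eqP xy /eqP yz; apply/eqP; rewrite -yz addrA xy. Qed.

HB.instance Definition _ := Choice.copy (natural M) M.
HB.instance Definition _ :=
  Order.Le_isPOrder.Build natural_display (natural M) le_refl le_anti le_trans.

End NaturalOrder.

Notation "x <=+ y" := ((x : natural _) <= (y : natural _))%O
  (at level 70, no associativity) : ring_scope.

Lemma naturalE (M : idemNmodType) (x y : M) : (x <=+ y) = (x + y == y).
Proof. by []. Qed.

Definition is_sup (M : idemNmodType) (U : set M) (s : M) : Prop :=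
  supremums (U : set (natural M)) s.

Definition complete_order (M : idemNmodType) : Prop :=
  forall U : set M, exists s : M, is_sup U s.

(* [U] may be empty. Suprema being unique, when [M] and [N] are complete this
   says that [f] maps the supremum of every subset to that of its image. *)
Definition sup_continuous (M N : idemNmodType) (f : M -> N) : Prop :=
  forall (U : set M) (s : M), is_sup U s -> is_sup (f @` U) (f s).

Definition complete_semiring (K : idemSemiRingType) : Prop :=
  [/\ complete_order K,
      forall a : K, sup_continuous (fun x : K => a * x)
    & forall a : K, sup_continuous (fun x : K => x * a)].

(* A right K-semimodule is a left semimodule over the converse semiring
   [K^c]; [x *> a] is the right action of [a] on [x]. *)
Definition ract (K : pzSemiRingType) (X : lSemiModType K^c) (x : X) (a : K)
  : X := (a : K^c) *: x.

Notation "x *> a" := (ract x a) (at level 40, left associativity) : ring_scope.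

Lemma ractA (K : pzSemiRingType) (X : lSemiModType K^c) (x : X) (a b : K) :
  x *> (a * b) = x *> a *> b.
Proof. by rewrite /ract scalerA. Qed.

Definition complete_rsemimodule (K : idemSemiRingType)
    (X : idemLSemiModType K^c) : Prop :=
  [/\ complete_order X,
      forall a : K, sup_continuous (fun x : X => x *> a)
    & forall v : X, sup_continuous (fun a : K => v *> a)].

Definition complete_subsemimodule (K : idemSemiRingType)
    (X : idemLSemiModType K^c) (V : set X) : Prop :=
  (forall (U : set X) (s : X), U `<=` V -> is_sup U s -> V s) /\
  (forall (v : X) (a : K), V v -> V (v *> a)).

(* The greatest element of [A]; the default value [0] is returned only when
   there is none. *)
Definition greatest (M : idemNmodType) (A : set M) : M :=
  xget 0 [set m | A m /\ forall a : M, A a -> a <=+ m].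

Definition residual (K : idemSemiRingType) (X : idemLSemiModType K^c)
    (x y : X) : K :=
  greatest [set a : K | x *> a <=+ y].

Notation "x \\ y" := (residual x y)
  (at level 40, left associativity) : ring_scope.

Definition projection (M : idemNmodType) (V : set M) (x : M) : M :=
  greatest [set v | V v /\ v <=+ x].

(* Main.v *)
(* For v in V, each multiple v a lies in V, so v a <= x iff v a <= P_V(x): both
   residuals are maxima of the same set. Conversely, if x \\ P_V(x) = x \\ x, then
   this scalar dominates the unit, hence x <= x (x \\ x) <= P_V(x) <= x. *)
Require Import Defs.
From HB Require Import structures.
From mathcomp Require Import all_boot all_order all_algebra.
From mathcomp Require Import boolp classical_sets.

Local Open Scope classical_set_scope.
Local Open Scope ring_scope.

(** A supremum lying in [A] is a greatest element of [A], so [xget] has a witness and does not fall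
    back on [0]. *)
Lemma greatestP {M : idemNmodType} {A : set M} {s : M} :
  is_sup A s -> A s ->
  A (greatest A) /\ forall a : M, A a -> a <=+ greatest A.
Proof.
move=> [s_ub _] As.
by apply: (xgetPex 0 (P := [set m | A m /\ forall a, A a -> a <=+ m])); exists s.
Qed.

Lemma ract_le (K : idemSemiRingType) (X : idemLSemiModType K^c) (x : X)
    (a b : K) : a <=+ b -> x *> a <=+ x *> b.
Proof.
rewrite !naturalE => /eqP ab; apply/eqP.
by rewrite -[in RHS]ab /ract -GRing.scalerDl.
Qed.

(** By continuity, [x *> s] is the supremum of the products [x *> a] lying below [y]; hence it is
    itself below [y], and the supremum [s] is attained. *)
Lemma residualP (K : idemSemiRingType) (K_complete : complete_order K)
    (X : idemLSemiModType K^c) (x y : X) :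
  sup_continuous (fun a : K => x *> a) ->
  x *> (x \\ y) <=+ y /\ forall a : K, x *> a <=+ y -> a <=+ x \\ y.
Proof.
move=> x_cont; have [s s_sup] := K_complete [set a | x *> a <=+ y].
apply: (greatestP s_sup); have [_ xs_least] := x_cont _ _ s_sup.
by apply: xs_least => _ [a ? <-].
Qed.

(** The elements of [V] below [x] have a supremum that stays in [V] by closure and below [x] by
    leastness. *)
Lemma projectionP (M : idemNmodType) (M_complete : complete_order M)
    (V : set M) (x : M) :
  (forall (U : set M) (s : M), U `<=` V -> is_sup U s -> V s) ->
  [/\ V (projection V x), projection V x <=+ x
    & forall v : M, V v -> v <=+ x -> v <=+ projection V x].
Proof.
move=> V_sup; have [s s_sup] := M_complete [set v | V v /\ v <=+ x].
have [] := greatestP s_sup.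
  split; first by apply: V_sup s_sup => v [].
  by have [_ s_least] := s_sup; apply: s_least => v [].
by move=> [VP Px] P_ub; split=> // v Vv vx; apply: P_ub.
Qed.

Theorem theorem8 (K : idemSemiRingType) (K_complete : complete_semiring K)
    (X : idemLSemiModType K^c) (X_complete : complete_rsemimodule X)
    (V : set X) (V_sub : complete_subsemimodule V) (x : X) :
  (forall v : X, V v -> v \\ projection V x = v \\ x) /\
  (V x <-> x \\ projection V x = x \\ x).
Proof.
have [K_sup _ _] := K_complete; have [X_sup _ x_cont] := X_complete.
have [V_sup V_act] := V_sub.
have [VP Px P_ub] := projectionP _ X_sup V x V_sup.
have res_proj (v : X) : V v -> v \\ projection V x = v \\ x.
  move=> Vv; congr (greatest _); apply/seteqP; split=> a /= va.
    exact: Order.POrderTheory.le_trans va Px.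
  by apply: P_ub => //; apply: V_act.
(* The direct implication is the first claim at [v = x]; the converse identifies [x] with its
   projection, which lies in [V]. *)
split=> //; split=> [/res_proj //|res_eq].
have [xr_le _] := residualP _ K_sup _ x (projection V x) (x_cont x).
have [_ r_ub] := residualP _ K_sup _ x x (x_cont x).
have x1 : x *> 1 = x by rewrite /ract; apply: GRing.scale1r.
have /(ract_le _ _ x) : 1 <=+ x \\ x by apply: r_ub; rewrite x1.
rewrite -res_eq x1 => x_le.
suff -> : x = projection V x by [].
apply: (@Order.POrderTheory.le_anti _ (natural X)).
by rewrite Px (Order.POrderTheory.le_trans x_le xr_le).
Qed.
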